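(* Let $b\ge 1$ be an integer, let $y_0,y_1,\dots,y_{2^b-1}$ be strictly monotonic quantization levels in $[0,1]$ (unsigned quantization) or in $[-1,1]$ (signed quantization), let $\beta\in[0,1)$, let $\Delta_t,\Delta_{t+1}>0$ be the scale factors at steps $t$ and $t+1$, let $q_t\in\{0,\dots,2^b-1\}$ be the quantized state at step $t$, and let $z_{t+1}\in\mathbb{R}$ be the signal received at step $t+1$. Let $q_{t+1}$ be the quantized state obtained from $q_t$ by one quantized EMA update with nearest rounding, i.e. $$q_{t+1}=\operatorname*{argmin}_{k\in\{0,\dots,2^b-1\}}\Big|\frac{\hat x_{t+1}}{\Delta_{t+1}}-y_k\Big|,\qquad \hat x_{t+1}=\beta\, y_{q_t}\Delta_t+(1-\beta)\,z_{t+1}.$$ Define the radius of the level $y_{q_t}$ by $$r=\tfrac12\min\big\{|y_{q_t}-y_{q_t-1}|,\ |y_{q_t+1}-y_{q_t}|\big\}.$$ If $$r\ \ge\ (1-\beta)\cdot\Big|\frac{z_{t+1}}{\Delta_{t+1}}-y_{q_t}\Big|+\Big|\frac{\Delta_t}{\Delta_{t+1}}-1\Big|,$$ then the quantized state remains unchanged: $q_{t+1}=q_t$.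
   Context: Quantized EMA (exponential moving average) update. A tensor entry is stored as an integer $q_t\in\{0,\dots,2^b-1\}$ together with a full-precision scale factor $\Delta_t>0$ (the maximum absolute value of the entries of the tensor that is quantized at step $t$; for this statement it may be treated as a given positive number). One update consists of: dequantization $\tilde x_t=y_{q_t}\Delta_t$; EMA update $\hat x_{t+1}=\beta\tilde x_t+(1-\beta)z_{t+1}$; quantization $q_{t+1}=\operatorname{argmin}_k|\hat x_{t+1}/\Delta_{t+1}-y_k|$ (nearest rounding). Conventions: in the definition of $r$, if $q_t=0$ or $q_t=2^b-1$, the term involving the nonexistent neighbouring level is omitted from the minimum. If the argmin is attained at two indices, ties are resolved in favour of $q_t$; equivalently, the conclusion ''$q_{t+1}=q_t$'' means that $k=q_t$ attains the minimum. *)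

(* Defs.v *)
From mathcomp Require Import all_boot all_order all_algebra reals.

Set Implicit Arguments.
Unset Strict Implicit.
Unset Printing Implicit Defensive.

Import Order.TTheory GRing.Theory Num.Theory.
Local Open Scope ring_scope.

Definition strictly_monotonic (R : realType) (n : nat) (y : 'I_n -> R) : Prop :=
  {homo y : i j / (i < j)%N >-> i < j} \/ {homo y : i j / (i < j)%N >-> i > j}.

Definition unsigned_levels (R : realType) (n : nat) (y : 'I_n -> R) : Prop :=
  forall k, 0 <= y k <= 1.

Definition signed_levels (R : realType) (n : nat) (y : 'I_n -> R) : Prop :=
  forall k, -1 <= y k <= 1.

(* [ord_pred] and [ordS] wrap around; the boundary tests keep exactly the gaps
   to neighbours that exist. For n = 1 there is no neighbour and the value is
   not meaningful. *)
Definition radius (R : realType) (n : nat) (y : 'I_n -> R) (q : 'I_n) : R :=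
  let gap_prev := `|y q - y (ord_pred q)| in
  let gap_next := `|y (ordS q) - y q| in
  2^-1 * (if val q == 0%N then gap_next
          else if val q == n.-1 then gap_prev
          else Num.min gap_prev gap_next).

Definition dequantize (R : realType) (n : nat) (y : 'I_n -> R) (D : R)
  (q : 'I_n) : R := y q * D.

Definition ema (R : realType) (beta x z : R) : R := beta * x + (1 - beta) * z.

(* The index set on which k |-> |u - y k| attains its minimum. *)
Definition nearest_levels (R : realType) (n : nat) (y : 'I_n -> R) (u : R) :
  {set 'I_n} := [set k | [forall j, `|u - y k| <= `|u - y j|]].

(* Ties are resolved in favour of q; in the other branch q is only the default
   index that [arg min] requires to know that 'I_n is nonempty. *)
Definition round_nearest (R : realType) (n : nat) (y : 'I_n -> R) (q : 'I_n)
  (u : R) : 'I_n :=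
  if q \in nearest_levels y u then q
  else [arg min_(k < q) `|u - y k|]%O.

(* D and D' are the scale factors before and after the update. *)
Definition quantized_ema_update (R : realType) (n : nat) (y : 'I_n -> R)
  (beta D D' z : R) (q : 'I_n) : 'I_n :=
  round_nearest y q (ema beta (dequantize y D q) z / D').

(* Main.v *)
(* With u the rescaled EMA value,
   u - y q = beta * y q * (D / D' - 1) + (1 - beta) * (z / D' - y q),
   so |y q| <= 1 and the hypothesis put u within the radius of y q. Since any
   other level is at least twice the radius away from y q, the triangle
   inequality makes q a minimiser. *)
Require Import Defs.
From mathcomp Require Import all_boot all_order all_algebra reals.
From mathcomp Require Import ring lra zify.

Set Implicit Arguments.
Unset Strict Implicit.
Unset Printing Implicit Defensive.

Import Order.TTheory GRing.Theory Num.Theory.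
Local Open Scope ring_scope.

(** Monotonicity keeps [y j] between [y i] and [y k], whichever way [y] runs. This compares a
    neighbouring level with any level beyond it. *)
Lemma strictly_monotonic_dist (R : realType) (n : nat) (y : 'I_n -> R)
  (i j k : 'I_n) :
  strictly_monotonic y -> (i <= j <= k)%N ->
  (`|y i - y j| <= `|y i - y k|) /\ (`|y j - y k| <= `|y i - y k|).
Proof.
move=> ymono /andP[le_ij le_jk].
have weak (f : 'I_n -> R) : {homo f : a c / (a < c)%N >-> a < c} ->
    {homo f : a c / (a <= c)%N >-> a <= c}.
  move=> finc a c; rewrite leq_eqVlt => /orP[/eqP/val_inj -> //|].
  by move=> /finc/ltW.
case: ymono => [yinc | ydec].
  have yij := weak y yinc _ _ le_ij; have yjk := weak y yinc _ _ le_jk.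
  have yik := le_trans yij yjk.
  by rewrite !ler0_norm ?subr_le0 //; split; lra.
(* A decreasing [y] is reduced to the increasing case through [- y]. *)
have Nyinc : {homo (fun a => - y a) : a c / (a < c)%N >-> a < c}.
  by move=> a c /ydec; rewrite ltrN2.
have := weak _ Nyinc _ _ le_ij; have := weak _ Nyinc _ _ le_jk.
rewrite !lerN2 => ykj yji; have yki := le_trans ykj yji.
by rewrite !ger0_norm ?subr_ge0 //; split; lra.
Qed.

(** The neighbour of [q] on the side of [j] exists and lies between [q] and [j] (possibly at [j]),
    so its gap bounds the distance from below and enters the radius. *)
Lemma radius_le_half_dist (R : realType) (n : nat) (y : 'I_n -> R)
  (q j : 'I_n) :
  strictly_monotonic y -> j != q -> 2 * radius y q <= `|y q - y j|.
Proof.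
move=> ymono; rewrite /radius mulrA divff ?mul1r ?pnatr_eq0 // => jq.
have [ltqj | ltjq | /val_inj eqj] := ltngtP q j; last by rewrite eqj eqxx in jq.
(* Since [q < j < n], the successor does not wrap around. *)
- have SqE : ordS q = q.+1 :> nat.
    by rewrite /= modn_small //; exact: leq_ltn_trans ltqj (ltn_ord j).
  have [near_next _] :
      (`|y q - y (ordS q)| <= `|y q - y j|) /\ (`|y (ordS q) - y j| <= `|y q - y j|).
    by apply: strictly_monotonic_dist => //; rewrite SqE leqnSn.
  rewrite distrC in near_next.
  have q_not_last : (val q == n.-1) = false by have := ltn_ord j; rewrite /=; lia.
  by rewrite q_not_last; case: ifP => _ //; rewrite ge_min near_next orbT.
(* Here [j < q] forces [0 < q], so the predecessor does not wrap around. *)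
- have PqE : ord_pred q = q.-1 :> nat.
    have ltqn := ltn_ord q; have -> : val (ord_pred q) = ((q + n).-1 %% n)%N by [].
    have -> : ((q + n).-1 = q.-1 + n)%N by lia.
    by rewrite modnDr modn_small //; lia.
  have [_ near_prev] :
      (`|y j - y (ord_pred q)| <= `|y j - y q|) /\ (`|y (ord_pred q) - y q| <= `|y j - y q|).
    by apply: strictly_monotonic_dist => //; rewrite PqE; lia.
  rewrite distrC [leRHS]distrC in near_prev.
  have q_not_first : (val q == 0%N) = false by rewrite /=; lia.
  by rewrite q_not_first; case: ifP => _ //; rewrite ge_min near_prev.
Qed.

Lemma ema_level_dist (R : realType) (beta D D' z x : R) :
  0 <= beta < 1 -> D' != 0 -> `|x| <= 1 ->
  `|ema beta (x * D) z / D' - x|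
    <= (1 - beta) * `|z / D' - x| + `|D / D' - 1|.
Proof.
move=> /andP[beta0 beta1] D'0 x1.
have -> : ema beta (x * D) z / D' - x
    = (1 - beta) * (z / D' - x) + beta * x * (D / D' - 1).
  by rewrite /ema; field.
apply: le_trans (ler_normD _ _) _; rewrite !normrM.
rewrite (ger0_norm beta0) [`|1 - beta|]ger0_norm ?subr_ge0 ?(ltW beta1) //.
(* The factor [beta * |x|] before the scale drift is at most 1. *)
by rewrite lerD2l ler_piMl // mulr_ile1 // ltW.
Qed.

Theorem theorem3p1 (R : realType) (b : nat) (hb : (1 <= b)%N)
  (y : 'I_(2 ^ b) -> R)
  (hmono : strictly_monotonic y)
  (hrange : unsigned_levels y \/ signed_levels y)
  (beta : R) (hbeta : 0 <= beta < 1)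
  (D D' : R) (hD : 0 < D) (hD' : 0 < D')
  (q : 'I_(2 ^ b)) (z : R)
  (hr : radius y q >= (1 - beta) * `|z / D' - y q| + `|D / D' - 1|) :
  quantized_ema_update y beta D D' z q = q.
Proof.
have yq1 : `|y q| <= 1.
  rewrite ler_norml; case: hrange => /(_ q) // /andP[yq0 ->].
  by rewrite andbT (le_trans _ yq0) // oppr_le0.
have u_near := le_trans (ema_level_dist D z hbeta (lt0r_neq0 hD') yq1) hr.
(* By the tie rule it suffices that [q] is one of the minimisers. *)
rewrite /quantized_ema_update /round_nearest ifT // inE.
apply/forallP => j; rewrite /dequantize.
have [-> // | jq] := eqVneq j q.
have gap := radius_le_half_dist hmono jq.
set u := ema _ _ _ / _ in u_near *.
(* With r the radius, 2r <= |y q - y j| <= |u - y q| + |u - y j| and |u - y q| <= r give |u - y q|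
   <= r <= |u - y j|. *)
have := ler_distD u (y q) (y j); rewrite (distrC (y q) u).
lra.
Qed.
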